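(* Let $\Gamma$ be a finite graph. Then $A(P_4)$ embeds into $A(\Gamma)$ if and only if $P_4$ is isomorphic to an induced subgraph of $\Gamma$.
   Context: A graph is a simplicial 1-complex (no loops, no multi-edges). For a graph $\Gamma$ with vertex set $V(\Gamma)$ and edge set $E(\Gamma)$, the right-angled Artin group is $A(\Gamma)=\langle V(\Gamma)\mid [v,v']=1 \text{ for each } \{v,v'\}\in E(\Gamma)\rangle$. $P_4$ is the path on four vertices. A group $H$ embeds into $G$ if there is an injective homomorphism $H\to G$. *)

(* Defs.v *)
From HB Require Import structures.
From mathcomp Require Import all_boot.
From mathcomp Require Import boolp.

Set Implicit Arguments.
Unset Strict Implicit.
Unset Printing Implicit Defensive.

Local Open Scope quotient_scope.

Record sgraph := SGraph {
  vertex :> finType;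
  adj : rel vertex;
  adj_sym : symmetric adj;
  adj_irrefl : irreflexive adj
}.

Definition graph_iso (G H : sgraph) : Prop :=
  exists f : G -> H, bijective f /\ forall x y : G, adj (f x) (f y) = adj x y.

Section Induced.
Variables (G : sgraph) (S : {set G}).

Definition induced_adj : rel {x : G | x \in S} :=
  fun x y => adj (val x) (val y).

Lemma induced_adj_sym : symmetric induced_adj.
Proof. by move=> x y; apply: adj_sym. Qed.

Lemma induced_adj_irrefl : irreflexive induced_adj.
Proof. by move=> x; apply: adj_irrefl. Qed.

Definition induced : sgraph := SGraph induced_adj_sym induced_adj_irrefl.
End Induced.

Definition P4_adj : rel 'I_4 := fun i j => (i.+1 == j) || (j.+1 == i).

Lemma P4_adj_sym : symmetric P4_adj.
Proof. by move=> i j; apply: orbC. Qed.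

Lemma P4_adj_irrefl : irreflexive P4_adj.
Proof. by move=> i; rewrite /P4_adj orbb gtn_eqF. Qed.

Definition P4 : sgraph := SGraph P4_adj_sym P4_adj_irrefl.

(* The group < X | R >: words in the letters (x, true), standing for x, and   *)
(* (x, false), standing for x^-1, modulo the least congruence that cancels    *)
(* inverse letters and kills the relators. *)
Section Presentation.
Variables (X : choiceType) (R : seq (X * bool) -> Prop).

Inductive pres_eq : seq (X * bool) -> seq (X * bool) -> Prop :=
| pres_refl u : pres_eq u u
| pres_sym u v : pres_eq u v -> pres_eq v u
| pres_trans u v w : pres_eq u v -> pres_eq v w -> pres_eq u w
| pres_cat u u' v v' :
    pres_eq u u' -> pres_eq v v' -> pres_eq (u ++ v) (u' ++ v')
| pres_cancel x b : pres_eq [:: (x, b); (x, ~~ b)] [::]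
| pres_relator r : R r -> pres_eq r [::].

Definition pres_eqb : rel (seq (X * bool)) := fun u v => `[< pres_eq u v >].

Lemma pres_eqb_refl : reflexive pres_eqb.
Proof. by move=> u; apply/asboolP; apply: pres_refl. Qed.

Lemma pres_eqb_sym : symmetric pres_eqb.
Proof. by move=> u v; apply/asboolP/asboolP; apply: pres_sym. Qed.

Lemma pres_eqb_trans : transitive pres_eqb.
Proof.
by move=> v u w /asboolP uv /asboolP vw; apply/asboolP; apply: pres_trans vw.
Qed.

Canonical pres_equiv :=
  EquivRel pres_eqb pres_eqb_refl pres_eqb_sym pres_eqb_trans.

Definition presented := {eq_quot pres_equiv}.
HB.instance Definition _ := EqQuotient.on presented.
HB.instance Definition _ := Choice.on presented.

Definition pres_class (u : seq (X * bool)) : presented := \pi_presented u.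

Lemma pres_classP u v : pres_class u = pres_class v <-> pres_eq u v.
Proof.
split=> [/(@eqmodP _ pres_equiv)/asboolP //|uv].
by apply/(@eqmodP _ pres_equiv)/asboolP.
Qed.

Definition inv_word (u : seq (X * bool)) : seq (X * bool) :=
  rev [seq (a.1, ~~ a.2) | a <- u].

Definition pres_one : presented := pres_class [::].
Definition pres_mul := lift_op2 presented cat.
Definition pres_inv := lift_op1 presented inv_word.

Lemma repr_pres_class u : pres_eq (repr (pres_class u)) u.
Proof. by apply/pres_classP; rewrite /pres_class reprK. Qed.

Lemma pres_class_repr (g : presented) : pres_class (repr g) = g.
Proof. exact: reprK. Qed.

Lemma pres_mulE u v :
  pres_mul (pres_class u) (pres_class v) = pres_class (u ++ v).
Proof.
rewrite /pres_mul -lock; apply/pres_classP.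
by apply: pres_cat; apply: repr_pres_class.
Qed.

Lemma pres_mulA : associative pres_mul.
Proof.
move=> g h k; rewrite -(pres_class_repr g) -(pres_class_repr h).
by rewrite -(pres_class_repr k) !pres_mulE catA.
Qed.

Lemma pres_mul1g : left_id pres_one pres_mul.
Proof. by move=> g; rewrite -(pres_class_repr g) pres_mulE. Qed.

Lemma pres_mulg1 : right_id pres_one pres_mul.
Proof. by move=> g; rewrite -(pres_class_repr g) pres_mulE cats0. Qed.

Lemma inv_wordK : involutive inv_word.
Proof.
move=> u; rewrite /inv_word map_rev revK -map_comp.
by rewrite -[RHS]map_id; apply: eq_map => -[x b] /=; rewrite negbK.
Qed.

Lemma pres_eq_mulV u : pres_eq (u ++ inv_word u) [::].
Proof.
elim: u => [|[x b] u IHu]; first exact: pres_refl.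
have -> : ((x, b) :: u) ++ inv_word ((x, b) :: u) =
    [:: (x, b)] ++ ((u ++ inv_word u) ++ [:: (x, ~~ b)]).
  by rewrite /inv_word /= rev_cons -cats1 catA.
apply: pres_trans (_ : pres_eq ([:: (x, b)] ++ ([::] ++ [:: (x, ~~ b)])) _).
  by apply/pres_cat/pres_cat; rewrite //; apply: pres_refl.
exact: pres_cancel.
Qed.

Lemma pres_mulgV : right_inverse pres_one pres_inv pres_mul.
Proof.
move=> g; rewrite -{1}(pres_class_repr g) /pres_inv -lock pres_mulE.
exact/pres_classP/pres_eq_mulV.
Qed.

Lemma pres_mulVg : left_inverse pres_one pres_inv pres_mul.
Proof.
move=> g; rewrite -{2}(pres_class_repr g) /pres_inv -lock pres_mulE.
apply/pres_classP.
by rewrite -{2}(inv_wordK (repr g)); apply: pres_eq_mulV.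
Qed.

HB.instance Definition _ := isGroup.Build presented
  pres_mulA pres_mul1g pres_mulg1 pres_mulVg pres_mulgV.

End Presentation.

Definition commutator_word (X : Type) (x y : X) : seq (X * bool) :=
  [:: (x, false); (y, false); (x, true); (y, true)].

Definition raag_relator (G : sgraph) (r : seq (G * bool)) : Prop :=
  exists v w : G, adj v w /\ r = commutator_word v w.

Definition raag (G : sgraph) : groupType := presented (@raag_relator G).

Definition embeds (H G : groupType) : Prop :=
  exists f : {multiplicative H -> G}, injective f.

(* Main.v *)
(** If [a, b, c, d] generate A(P4) along the path, then [[a, c], [b, d]] is
    nontrivial, as a homomorphism to S_5 shows.  Conversely, in A(G) with G free
    of induced P4, any [a, b, c, d] whose consecutive terms commute satisfy
    [[a, c], [b, d]] = 1.  This is proved by induction on the set of vertices,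
    since a P4-free graph on at least two vertices is a join or a disjoint union
    of two smaller ones.  A join gives a direct product, where the claim is
    immediate.  A disjoint union gives a free product; there, if [a] and [c] do
    not commute, then the centralizer of [b] is not abelian, so that [b] is
    conjugate into a factor, and the centralizers of [b] and then of [c] (when
    these are not 1) confine [a], [c] and [d] to the same factor.
    If P4 is induced in G, then A(P4) is a retract of A(G). *)

Require Import Defs.
From mathcomp Require Import all_boot.
From HB Require Import structures.
From mathcomp Require Import perm.

Set Implicit Arguments.
Unset Strict Implicit.
Unset Printing Implicit Defensive.

Local Open Scope group_scope.

(** * Homomorphisms out of a presented group *)

Section Letters.
Variables (X : choiceType) (H : groupType) (f : X -> H).

Definition letter (a : X * bool) : H := if a.2 then f a.1 else (f a.1)^-1.

Definition word_value (u : seq (X * bool)) : H := \prod_(a <- u) letter a.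

Lemma word_value_cat u v : word_value (u ++ v) = word_value u * word_value v.
Proof. exact: big_cat. Qed.

Lemma word_value1 a : word_value [:: a] = letter a.
Proof. exact: big_seq1. Qed.

Lemma word_value_commutator x y :
  word_value (commutator_word x y) = [~ f x, f y].
Proof. by rewrite /word_value !big_cons big_nil mulg1. Qed.

End Letters.

Section PresentedGroups.
Variables (X : choiceType) (R : seq (X * bool) -> Prop).

Definition gen (x : X) : presented R := pres_class R [:: (x, true)].

Lemma pres_class_cat u v :
  pres_class R (u ++ v) = pres_class R u * pres_class R v.
Proof. by rewrite -[RHS]/(pres_mul _ _) pres_mulE. Qed.

Lemma letter_gen x b : letter gen (x, b) = pres_class R [:: (x, b)].
Proof.
case: b => //; rewrite /letter /=; apply/eqP; rewrite eq_sym -mulg_eq1.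
by rewrite -pres_class_cat; apply/eqP/pres_classP/(pres_cancel R x false).
Qed.

Lemma presented_ind (Q : presented R -> Prop) :
  Q 1 -> (forall a g, Q g -> Q (letter gen a * g)) -> forall g, Q g.
Proof.
move=> Q1 QM g; rewrite -(pres_class_repr g).
elim: (repr g) => [|[x b] u IHu]; first exact: Q1.
by rewrite -cat1s pres_class_cat -letter_gen; apply: QM.
Qed.

Section Extension.
Variables (H : groupType) (f : X -> H).
Hypothesis f_rel : forall r, R r -> word_value f r = 1.

Lemma word_value_pres_eq u v :
  pres_eq R u v -> word_value f u = word_value f v.
Proof.
elim=> [//|{}u {}v _ -> //|{}u {}v w _ -> _ -> //|||r /f_rel ->].
- by move=> {}u u' {}v v' _ eq_u _ eq_v; rewrite !word_value_cat eq_u eq_v.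
- move=> x b; rewrite /word_value !big_cons big_nil mulg1 /letter /=.
  by case: b; rewrite ?mulgV ?mulVg.
- by rewrite /word_value big_nil.
Qed.

(** The condition on relators is an argument, so that the morphism structure declared below can be
    inferred from the term alone. *)
Definition pres_lift of (forall r, R r -> word_value f r = 1) :=
  fun g : presented R => word_value f (repr g).

Local Notation lift := (pres_lift f_rel).

Lemma pres_lift_class u : lift (pres_class R u) = word_value f u.
Proof. exact/word_value_pres_eq/repr_pres_class. Qed.

Lemma pres_lift_monoid_morphism : monoid_morphism lift.
Proof.
split=> [|g h]; first by rewrite -[1]/(pres_one R) pres_lift_class [LHS]big_nil.
rewrite -(pres_class_repr g) -(pres_class_repr h).
by rewrite -pres_class_cat !pres_lift_class word_value_cat.
Qed.

HB.instance Definition _ := isUMagmaMorphism.Build (presented R) H lift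
  pres_lift_monoid_morphism.

Lemma pres_lift_letter a : lift (letter gen a) = letter f a.
Proof. by case: a => x b; rewrite letter_gen pres_lift_class word_value1. Qed.

Lemma pres_lift_gen x : lift (gen x) = f x.
Proof. exact: (pres_lift_letter (x, true)). Qed.

End Extension.

Lemma pres_morph_ext (H : groupType) (F F' : UMagmaMorphism.type (presented R) H) :
  (forall x, F (gen x) = F' (gen x)) -> F =1 F'.
Proof.
move=> eqF; apply: presented_ind => [|[x b] g IHg]; first by rewrite !gmulf1.
rewrite !gmulfM IHg; congr (_ * _).
by case: b; rewrite /letter /= ?gmulfV eqF.
Qed.

End PresentedGroups.

(** * Free products: reduced words *)

Section Syllables.
Variables (P : groupType) (A : bool -> groupClosed P).
Implicit Types (s t r : seq (bool * P)) (i : bool) (x y : P).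

Definition syllable (p : bool * P) := (p.2 \in A p.1) && (p.2 != 1).

Definition reduced s := all syllable s && sorted (fun p q => p.1 != q.1) s.

Definition syl_prod s : P := \prod_(p <- s) p.2.

(** The default type concerns the empty word, which the statements below exclude or single out; in
    [last_type_inv] both sides share this default. *)
Definition first_type s := (head (true, 1) s).1.
Definition last_type s := (last (true, 1) s).1.

Lemma syl_prod_nil : syl_prod [::] = 1.
Proof. exact: big_nil. Qed.

Lemma syl_prod_cons p s : syl_prod (p :: s) = p.2 * syl_prod s.
Proof. exact: big_cons. Qed.

Lemma syl_prod_cat s t : syl_prod (s ++ t) = syl_prod s * syl_prod t.
Proof. exact: big_cat. Qed.

Lemma syl_prod_rcons s p : syl_prod (rcons s p) = syl_prod s * p.2.
Proof. by rewrite -cats1 syl_prod_cat syl_prod_cons syl_prod_nil mulg1. Qed.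

Lemma reduced_cat s t : s != [::] -> t != [::] ->
  reduced (s ++ t) = [&& reduced s, reduced t & last_type s != first_type t].
Proof.
case: s t => [|p s] [|q t] // _ _.
rewrite /reduced all_cat /= cat_path /= /last_type /first_type /=.
by case: (syllable p) (all _ s) (syllable q) (all _ t) => [] [] [] [] //=;
  rewrite ?andbF //=; case: (path _ p s); rewrite //= andbC.
Qed.

Lemma reduced1 p : reduced [:: p] = syllable p.
Proof. by rewrite /reduced /= !andbT. Qed.

Lemma reduced_cons p s : reduced (p :: s) =
  [&& syllable p, reduced s & (s == [::]) || (p.1 != first_type s)].
Proof.
case: s => [|q s]; first by rewrite reduced1 !andbT.
by rewrite -cat1s reduced_cat ?reduced1.
Qed.

Lemma reduced_rcons s p : reduced (rcons s p) =
  [&& reduced s, syllable p & (s == [::]) || (last_type s != p.1)].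
Proof.
case: s => [|q s]; first by rewrite reduced1 !andbT.
by rewrite -cats1 reduced_cat ?reduced1.
Qed.

Definition syl_inv s := rev [seq (p.1, p.2^-1) | p <- s].

Lemma syl_prod_inv s : syl_prod (syl_inv s) = (syl_prod s)^-1.
Proof.
elim: s => [|p s IHs]; first by rewrite syl_prod_nil invg1.
by rewrite /syl_inv /= rev_cons syl_prod_rcons IHs syl_prod_cons invgM.
Qed.

Lemma size_syl_inv s : size (syl_inv s) = size s.
Proof. by rewrite size_rev size_map. Qed.

Lemma last_type_inv s : last_type (syl_inv s) = first_type s.
Proof.
by case: s => // p s; rewrite /last_type /syl_inv /= rev_cons last_rcons.
Qed.

Lemma reduced_inv s : reduced s -> reduced (syl_inv s).
Proof.
elim: s => // p s IHs; rewrite reduced_cons /syl_inv /= rev_cons.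
case/and3P=> /andP[Ap p1] /IHs red_s st; rewrite reduced_rcons red_s /=.
rewrite /syllable /= gpredV Ap invg_eq1 p1 /=.
rewrite -/(syl_inv s) last_type_inv [_ == p.1]eq_sym.
by rewrite -size_eq0 size_syl_inv size_eq0.
Qed.

(** Van der Waerden's action of the factor [A i] on reduced words. It is a total function of [x];
    membership in [A i] enters in [reduced_mul]. *)
Definition syl_mul i x s :=
  if x == 1 then s else
  if s is p :: s' then
    if i == p.1 then (if x * p.2 == 1 then s' else (i, x * p.2) :: s')
    else (i, x) :: s
  else [:: (i, x)].

Lemma syl_mul1 i s : syl_mul i 1 s = s.
Proof. by rewrite /syl_mul eqxx. Qed.

Lemma syl_mul_new i x s : x != 1 -> (s == [::]) || (i != first_type s) ->
  syl_mul i x s = (i, x) :: s.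
Proof.
by rewrite /syl_mul => /negPf->; case: s => // p s /= /negPf; rewrite /= => ->.
Qed.

Lemma syl_mul_old i x y s : y != 1 ->
  syl_mul i x ((i, y) :: s) = if x * y == 1 then s else (i, x * y) :: s.
Proof.
rewrite /syl_mul /= eqxx => /negPf y1.
by case: (eqVneq x 1) => // ->; rewrite mul1g y1.
Qed.

Lemma syl_mulP i s : reduced s ->
  (s == [::]) || (i != first_type s) \/
  exists x s', [/\ s = (i, x) :: s', x \in A i, x != 1, reduced s'
    & (s' == [::]) || (i != first_type s')].
Proof.
case: s => [|[j x] s]; first by left.
rewrite reduced_cons => /and3P[/andP[/= Ax x1] red_s sep].
have [<-|ij] := eqVneq j i; last by left; rewrite eq_sym in ij.
by right; exists x, s.
Qed.

Lemma syl_prod_mul i x s : reduced s ->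
  syl_prod (syl_mul i x s) = x * syl_prod s.
Proof.
move=> red_s; have [->|x1] := eqVneq x 1; first by rewrite mul1g syl_mul1.
case: (syl_mulP i red_s) => [new|[y [t [-> _ y1 _ _]]]].
  by rewrite syl_mul_new // syl_prod_cons.
rewrite syl_mul_old //; case: eqP => [xy1|_]; rewrite !syl_prod_cons mulgA //=.
by rewrite xy1 mul1g.
Qed.

Lemma reduced_mul i x s : x \in A i -> reduced s -> reduced (syl_mul i x s).
Proof.
move=> Ax red_s; have [->|x1] := eqVneq x 1; first by rewrite syl_mul1.
case: (syl_mulP i red_s) => [new|[y [t [-> Ay y1 red_t new]]]].
  by rewrite syl_mul_new // reduced_cons /syllable Ax x1 red_s.
rewrite syl_mul_old //; case: eqP => // /eqP xy1.
by rewrite reduced_cons /syllable gpredM //= xy1 red_t.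
Qed.

(** The action law. The cases are whether [s] begins with type [i] and which of the partial products
    become 1. *)
Lemma syl_mulM i x y s : reduced s ->
  syl_mul i (x * y) s = syl_mul i x (syl_mul i y s).
Proof.
move=> red_s; have [->|y1] := eqVneq y 1; first by rewrite mulg1 syl_mul1.
case: (syl_mulP i red_s) => [new|[z [t [-> Az z1 _ new]]]].
  rewrite [syl_mul i y s]syl_mul_new // syl_mul_old //.
  by case: (eqVneq (x * y) 1) => [->|xy1]; rewrite ?syl_mul1 ?syl_mul_new.
rewrite !syl_mul_old // -mulgA; case: (eqVneq (y * z) 1) => [->|yz1].
  rewrite mulg1; case: (eqVneq x 1) => [->|x1]; first by rewrite syl_mul1.
  by rewrite syl_mul_new.
by rewrite syl_mul_old.
Qed.

Lemma syl_mul_cons p s : reduced (p :: s) -> syl_mul p.1 p.2 s = p :: s.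
Proof.
rewrite reduced_cons => /and3P[/andP[_ p1] _ new].
by rewrite syl_mul_new //; case: p {p1 new}.
Qed.

(** Only the first syllable is touched, so a second one protects the end of the word. *)
Lemma syl_mul_last i x s : 2 <= size s ->
  size s <= (size (syl_mul i x s)).+1 /\ last_type (syl_mul i x s) = last_type s.
Proof.
rewrite /syl_mul; case: ifP => // _; case: s => [|p [|q s]] //= _.
by do ?[case: ifP => _]; split=> //=; rewrite ?ltnS ?leqnSn // -addn2 leq_addr.
Qed.

(** Each syllable of [s] destroys at most one syllable of the longer word [t], so the last syllable
    of [t] is never reached. *)
Lemma reduced_prodM s t : reduced s -> reduced t -> size s < size t ->
  exists r, [/\ reduced r, syl_prod r = syl_prod s * syl_prod t, r != [::]
    & last_type r = last_type t].
Proof.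
move=> red_s red_t st.
(* The size bound is what carries the induction: it leaves at least two syllables before each
   multiplication, as [syl_mul_last] requires. *)
suff [r [red_r er szr lr]] : exists r, [/\ reduced r,
    syl_prod r = syl_prod s * syl_prod t, size t <= size r + size s
    & last_type r = last_type t].
  exists r; split=> //; rewrite -size_eq0 -lt0n.
  by rewrite -(ltn_add2r (size s)) (leq_trans st).
elim: s red_s st => [|p s IHs] /= red_s st.
  by exists t; rewrite syl_prod_nil mul1g addn0.
move: red_s; rewrite reduced_cons => /and3P[/andP[Ap _] red_s _].
have [r [red_r er szr lr]] := IHs red_s (ltnW st).
exists (syl_mul p.1 p.2 r).
have sz_r : 2 <= size r.
  by rewrite -(leq_add2r (size s)) (leq_trans st).
have [sz1 l1] := syl_mul_last p.1 p.2 sz_r.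
split; [exact: reduced_mul | | | by rewrite l1]; last first.
  by rewrite addnS -addSn (leq_trans szr) ?leq_add2r.
by rewrite syl_prod_mul // er syl_prod_cons mulgA.
Qed.

End Syllables.

(** * Free products: centralizers *)

Lemma cat_commute_iter (T : Type) (u s : seq T) n : u ++ s = s ++ u ->
  u ++ flatten (nseq n s) = flatten (nseq n s) ++ u.
Proof.
by move=> us; elim: n => [|n IHn] /=; rewrite ?cats0 // catA us -!catA IHn.
Qed.

(* Both [u] and [v] are prefixes of a large power of [s]. *)
Lemma cat_commute_trans (T : Type) (s u v : seq T) : size s != 0 ->
  u ++ s = s ++ u -> v ++ s = s ++ v -> u ++ v = v ++ u.
Proof.
move=> s0 us vs; pose w := flatten (nseq (size u + size v) s).
have sz_w : size u + size v <= size w.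
  by rewrite size_flatten /shape map_nseq sumn_nseq leq_pmull ?lt0n.
suff prefix_w (u' v' : seq T) : size u' + size v' <= size w ->
    u' ++ w = w ++ u' -> v' ++ w = w ++ v' ->
    u' ++ v' = take (size u' + size v') w.
  have uw := cat_commute_iter (size u + size v) us.
  have vw := cat_commute_iter (size u + size v) vs.
  by rewrite (prefix_w u v) // addnC (prefix_w v u) // addnC.
move=> szw u'w v'w.
have ev : v' = take (size v') w.
  have szv : size v' <= size w by rewrite (leq_trans _ szw) ?leq_addl.
  by rewrite -(takel_cat v' szv) -v'w take_size_cat.
by rewrite -(takel_cat u' szw) -u'w take_cat ltnNge leq_addr /= addKn -ev.
Qed.

(** [D] is any predicate, so that the law applies to the subgroups [sub S], to [in_free_product] and
    to a whole group. *)
Definition P4_law (P : groupType) (D : P -> Prop) :=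
  forall a b c d, D a -> D b -> D c -> D d ->
  commute a b -> commute b c -> commute c d -> [~ [~ a, c], [~ b, d]] = 1.

Section FreeProduct.
Variables (P : groupType) (A : bool -> groupClosed P).

Local Notation reduced := (reduced A).
Local Notation prod := (@syl_prod P).

(** Uniqueness of normal forms: inside [P], the two factors generate their free product. *)
Hypothesis prod_inj : {in reduced &, injective prod}.

Definition in_free_product (g : P) := exists2 s, reduced s & prod s = g.

Local Notation D := in_free_product.

Lemma in_free_product_factor i x : x \in A i -> D x.
Proof.
move=> Ax; exists (syl_mul i x [::]); first exact: reduced_mul.
by rewrite (@syl_prod_mul P A) // syl_prod_nil mulg1.
Qed.

Lemma in_free_productM g h : D g -> D h -> D (g * h).
Proof.
case=> s red_s <- {g}; elim: s red_s h => [|p s IHs] red_s h Dh.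
  by rewrite syl_prod_nil mul1g.
move: red_s; rewrite reduced_cons syl_prod_cons -mulgA.
case/and3P=> /andP[Ap _] /IHs/(_ _ Dh)[r red_r er] _.
exists (syl_mul p.1 p.2 r); first exact: reduced_mul.
by rewrite (@syl_prod_mul P A) // er.
Qed.

Lemma in_free_productV g : D g -> D g^-1.
Proof.
by case=> s /reduced_inv red_s <-; exists (syl_inv s); rewrite ?syl_prod_inv.
Qed.

Lemma in_free_productJ g h : D g -> D h -> D (g ^ h).
Proof.
by move=> Dg Dh; do ![apply: in_free_productM => //]; apply: in_free_productV.
Qed.

(** For nonempty [t] the left side has normal form [(i, y) :: t]. If [t] ends in type [i], then [x]
    merges with its last syllable and the right side is too short. Otherwise the right side is
    [rcons t (i, x)], whose first syllable is that of [t], not of type [i]. *)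
Lemma factor_conj_reduced i x y t : x \in A i -> x != 1 -> y \in A i ->
  reduced t -> (t == [::]) || (i != first_type t) ->
  y * prod t = prod t * x -> t = [::].
Proof.
move=> Ax x1 Ay red_t t_i eq_yt; have [-> //|t0] := eqVneq t [::].
have y1 : y != 1.
  apply: contra_neq x1 => y1; apply: (mulgI (prod t)).
  by rewrite -eq_yt y1 mul1g mulg1.
have red_yt : reduced ((i, y) :: t).
  by rewrite reduced_cons /syllable Ay y1 red_t.
have eq_yt' : prod ((i, y) :: t) = prod t * x by rewrite syl_prod_cons.
case/lastP: t red_t t0 t_i eq_yt' red_yt {eq_yt} => // t [j z].
rewrite {1}reduced_rcons => /and3P[red_t /andP[/= Az z1] t_j] t0 t_i eq_yt red_yt.
have [ij|ij] := eqVneq j i; last first.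
  have : (i, y) :: rcons t (j, z) = rcons (rcons t (j, z)) (i, x).
    apply: prod_inj; rewrite //.
      rewrite -topredE /= !reduced_rcons red_t t_j /syllable /= Ax x1 Az z1 /=.
      by rewrite /last_type last_rcons ij orbT.
    by rewrite syl_prod_rcons.
  by case: t t_i {red_t t_j t0 eq_yt red_yt} => [|p t] /= t_i [ip];
    rewrite -?ip /first_type /= ?ip eqxx in t_i.
rewrite {}ij in Az t_j eq_yt red_yt *.
have eq_zx : prod (rcons t (i, z)) * x = prod t * (z * x).
  by rewrite syl_prod_rcons mulgA.
have [zx|zx] := eqVneq (z * x) 1.
  have /(congr1 size) : (i, y) :: rcons t (i, z) = t.
    by apply: prod_inj; rewrite // eq_yt eq_zx zx mulg1.
  by rewrite /= size_rcons => /eqP; rewrite gtn_eqF.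
have /(congr1 size) : (i, y) :: rcons t (i, z) = rcons t (i, z * x).
  apply: prod_inj; rewrite //; last by rewrite eq_yt eq_zx syl_prod_rcons.
  by rewrite -topredE /= reduced_rcons red_t /syllable /= gpredM ?zx.
by rewrite /= !size_rcons => /eqP; rewrite gtn_eqF.
Qed.

(** A first syllable [y] of type [i] is stripped off, if there is one. The rest [t] satisfies
    [x ^ y * prod t = prod t * x], hence is empty by [factor_conj_reduced]. *)
Lemma factor_centralizer i x g : x \in A i -> x != 1 -> D g -> commute g x ->
  g \in A i.
Proof.
move=> Ax x1 [s red_s <-] comm_sx.
case: (syl_mulP i red_s) => [s_i|[y [t [es Ay y1 red_t t_i]]]].
  have es : s = [::] by apply: (factor_conj_reduced Ax x1 Ax red_s s_i).
  by rewrite es syl_prod_nil gpred1.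
have Axy : x ^ y \in A i by apply: gpredJ.
have et : t = [::].
  apply: (factor_conj_reduced Ax x1 Axy red_t t_i).
  move: comm_sx; rewrite es syl_prod_cons /commute /= /conjg -!mulgA => <-.
  by rewrite mulKg.
by rewrite es et syl_prod_cons syl_prod_nil mulg1.
Qed.

(** * Centralizers of cyclically reduced words with at least two syllables *)

Section Hyperbolic.
Variable s : seq (bool * P).
Hypotheses (red_s : reduced s) (s0 : s != [::]).
Hypothesis cyc_s : last_type s != first_type s.

Let pow n := flatten (nseq n s).

Lemma prod_pow n : prod (pow n) = prod s ^+ n.
Proof.
elim: n => [|n IHn]; first by rewrite syl_prod_nil.
by rewrite /pow /= syl_prod_cat -/(pow n) IHn expgS.
Qed.

Lemma pow_types n : [/\ pow n.+1 != [::], reduced (pow n.+1),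
  first_type (pow n.+1) = first_type s & last_type (pow n.+1) = last_type s].
Proof.
elim: n => [|n [pow0 red_pow fst_pow lst_pow]]; first by rewrite /pow /= cats0.
rewrite -[pow n.+2]/(s ++ pow n.+1).
have nz : s ++ pow n.+1 != [::] by case: (s) s0.
split=> //; first by rewrite reduced_cat // red_s red_pow fst_pow.
- by case: (s) s0.
- rewrite -lst_pow /last_type last_cat.
  by case: (pow n.+1) pow0.
Qed.

(* No cancellation remains at either end of [g b^n] once [n] exceeds the      *)
(* length of [g]. *)
Lemma hyperbolic_centralizer_pow g : D g -> commute g (prod s) ->
  exists n r, [/\ reduced r, prod r = g * prod s ^+ n, r != [::],
    first_type r = first_type s & last_type r = last_type s].
Proof.
case=> t red_t <- comm_ts; exists (size t).+1.
have [pow0 red_pow fst_pow lst_pow] := pow_types (size t).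
have sz_pow : size t < size (pow (size t).+1).
  by rewrite /pow size_flatten /shape map_nseq sumn_nseq leq_pmull // lt0n size_eq0.
have [r [red_r er r0 lr]] := reduced_prodM red_t red_pow sz_pow.
exists r; split; rewrite ?er ?prod_pow ?lr //.
(* The first type of [r] is the last type of its inverse. As the two factors commute, that inverse
   is again a short word times a long one, so [reduced_prodM] applies a second time. *)
have [|q [red_q eq q0 lq]] :=
  reduced_prodM (reduced_inv red_t) (reduced_inv red_pow).
  by rewrite !size_syl_inv.
rewrite -(last_type_inv r) -fst_pow -last_type_inv -lq; congr last_type.
apply: prod_inj; rewrite ?[_ \in _]reduced_inv //.
rewrite eq !syl_prod_inv er -invgM prod_pow; congr _^-1.
exact: commuteX.
Qed.

(** After multiplication by suitable powers of [prod s], the normal forms of [g] and [h] concatenate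
    with [s] on either side without cancellation. By uniqueness they commute with [s] as words,
    hence with each other by [cat_commute_trans]. *)
Lemma hyperbolic_centralizer_abelian g h : D g -> D h ->
  commute g (prod s) -> commute h (prod s) -> commute g h.
Proof.
move=> Dg Dh gs hs.
have [n [u [red_u eu u0 fu lu]]] := hyperbolic_centralizer_pow Dg gs.
have [m [v [red_v ev v0 fv lv]]] := hyperbolic_centralizer_pow Dh hs.
have word_commute g' k r : commute g' (prod s) -> reduced r ->
    prod r = g' * prod s ^+ k -> r != [::] ->
    first_type r = first_type s -> last_type r = last_type s ->
    r ++ s = s ++ r.
  move=> g's red_r er r0 fr lr; apply: prod_inj.
  - by rewrite -topredE /= reduced_cat // red_r red_s lr.
  - by rewrite -topredE /= reduced_cat // red_r red_s fr.
  - rewrite !syl_prod_cat er; apply: commute_sym; apply: commuteM.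
      exact: commute_sym.
    exact: commuteX.
have us : u ++ s = s ++ u by apply: (word_commute g n).
have vs : v ++ s = s ++ v by apply: (word_commute h m).
have {us vs} : u ++ v = v ++ u.
  by apply: (cat_commute_trans _ us vs); rewrite size_eq0.
move/(congr1 prod); rewrite !syl_prod_cat eu ev => comm.
(* The powers of [prod s] commute with [g], with [h] and with one another, so they can now be
   removed. *)
have bg k : commute (prod s ^+ k) g by apply/commute_sym/commuteX.
have bh k : commute (prod s ^+ k) h by apply/commute_sym/commuteX.
have gX k : commute g (prod s ^+ k) by apply: commuteX.
have bX k l : commute (prod s ^+ k) (prod s ^+ l) by apply: commuteX2.
have {comm} gh : commute (g * prod s ^+ n) (h * prod s ^+ m) by [].
have {gh} /commute_sym gh : commute (g * prod s ^+ n) h.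
  rewrite -(mulgK (prod s ^+ m) h); apply: commuteM => //.
  by apply: commuteV; apply/commute_sym/commuteM; [apply: bg | apply: bX].
apply/commute_sym; rewrite -(mulgK (prod s ^+ n) g); apply: commuteM => //.
by apply: commuteV; apply: commute_sym; apply: bh.
Qed.

End Hyperbolic.

(** Conjugation by the first syllable moves it to the end, where it merges with a last syllable of
    the same type; the word gets shorter. *)
Lemma cyclically_reduce g : D g -> exists z, D z /\
  ((exists i, g ^ z \in A i) \/
   exists s, [/\ reduced s, s != [::], last_type s != first_type s
     & prod s = g ^ z]).
Proof.
case=> s red_s <-; have [n] := ubnP (size s); elim: n => // n IHn in s red_s *.
have D1 : D 1 by exists [::]; rewrite ?syl_prod_nil.
case: s red_s => [|p s] red_s.
  by exists 1; split=> //; left; exists true; rewrite conjg1 syl_prod_nil gpred1.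
move: (red_s); rewrite reduced_cons => /and3P[/andP[Ap p1] red_s' p_s] /= /ltnSE sz.
case/lastP: s => [|s q] in red_s red_s' p_s sz *.
  exists 1; split=> //; left; exists p.1.
  by rewrite conjg1 syl_prod_cons syl_prod_nil mulg1.
have [pq|pq] := eqVneq q.1 p.1; last first.
  exists 1; split=> //; right; exists (p :: rcons s q).
  by split; rewrite ?conjg1 // /last_type /first_type /= last_rcons.
move: red_s'; rewrite reduced_rcons => /and3P[red_s' /andP[Aq q1] s_q].
have Dp : D p.2 by apply: in_free_product_factor Ap.
have e : prod (p :: rcons s q) ^ p.2 = prod s * (q.2 * p.2).
  by rewrite syl_prod_cons syl_prod_rcons /conjg mulgA mulKg mulgA.
suff [t [red_t et sz_t]] : exists t, [/\ reduced t,
    prod t = prod s * (q.2 * p.2) & size t < n].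
  have [z [Dz Hz]] := IHn t red_t sz_t.
  by exists (p.2 * z); split; [exact: in_free_productM | rewrite conjgM e -et].
rewrite size_rcons in sz.
have [qp|qp] := eqVneq (q.2 * p.2) 1.
  by exists s; rewrite qp mulg1; split=> //; apply: leq_trans sz.
exists (rcons s (q.1, q.2 * p.2)); rewrite syl_prod_rcons size_rcons; split=> //.
by rewrite reduced_rcons red_s' /syllable qp gpredM //= pq.
Qed.

(** The law is invariant under conjugation, so [b] can be replaced by its cyclically reduced
    conjugate: either a hyperbolic element, with abelian centralizer, or an element of a factor. *)
Lemma free_product_P4_law : (forall i, P4_law (fun g => g \in A i)) -> P4_law D.
Proof.
move=> lawA a b c d Da Db Dc Dd ab bc cd.
have [->|b1] := eqVneq b 1; first by rewrite comm1g commg1.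
have [->|c1] := eqVneq c 1; first by rewrite commg1 comm1g.
have [z [Dz bz]] := cyclically_reduce Db.
have Jz g h : commute g h -> commute (g ^ z) (h ^ z).
  by rewrite /commute -!conjMg => ->.
have DJz g : D g -> D (g ^ z) by move=> Dg; apply: in_free_productJ.
apply/eqP; rewrite -(conjg_eq1 _ z) !conjRg; apply/eqP.
case: bz => [[i Ab]|[s [red_s s0 cyc_s es]]]; last first.
  suff /commgP/eqP-> : commute (a ^ z) (c ^ z) by rewrite comm1g.
  apply: (hyperbolic_centralizer_abelian red_s s0 cyc_s); rewrite ?es; auto.
  exact/Jz/commute_sym.
have b1z : b ^ z != 1 by rewrite conjg_eq1.
have c1z : c ^ z != 1 by rewrite conjg_eq1.
have Aa : a ^ z \in A i by apply: (factor_centralizer Ab b1z); auto.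
have Ac : c ^ z \in A i.
  by apply: (factor_centralizer Ab b1z); [|apply: commute_sym]; auto.
have Ad : d ^ z \in A i.
  by apply: (factor_centralizer Ac c1z); [|apply: commute_sym]; auto.
by apply: (lawA i); auto.
Qed.

End FreeProduct.

(** * Right-angled Artin groups *)

Section Raag.
Variable G : sgraph.
Implicit Types (S T : {set G}) (v w : G).

Definition vgen v : raag G := gen (@raag_relator G) v.

Lemma vgen_commute v w : adj v w -> commute (vgen v) (vgen w).
Proof.
move=> vw; apply/commgP/eqP; rewrite -word_value_commutator.
rewrite -[RHS]/(pres_class (@raag_relator G) [::]).
have -> : word_value vgen (commutator_word v w)
    = pres_class (@raag_relator G) (commutator_word v w).
  by rewrite /word_value !big_cons big_nil mulg1 !letter_gen -!pres_class_cat.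
by apply/pres_classP/pres_relator; exists v, w.
Qed.

Lemma raag_relator_value (H : groupType) (f : G -> H) :
  (forall v w, adj v w -> commute (f v) (f w)) ->
  forall r, raag_relator r -> word_value f r = 1.
Proof.
move=> fC _ [v [w [vw ->]]]; rewrite word_value_commutator.
exact/eqP/commgP/fC.
Qed.

Definition ret_vertex S v : raag G := if v \in S then vgen v else 1.

Lemma ret_vertex_commute S v w :
  adj v w -> commute (ret_vertex S v) (ret_vertex S w).
Proof.
rewrite /ret_vertex => vw; case: ifP => _; last exact/commute_sym/commute1.
by case: ifP => _; [apply: vgen_commute | apply: commute1].
Qed.

Definition ret S : UMagmaMorphism.type (raag G) (raag G) :=
  pres_lift (raag_relator_value (@ret_vertex_commute S)).

Lemma ret_letter S a :
  ret S (letter vgen a) = if a.1 \in S then letter vgen a else 1.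
Proof.
rewrite [LHS]pres_lift_letter /letter /ret_vertex.
by case: a => v [] //=; case: ifP => _; rewrite ?invg1.
Qed.

Lemma ret_gen S v : ret S (vgen v) = ret_vertex S v.
Proof. exact: pres_lift_gen. Qed.

Lemma ret_comp S T g : ret S (ret T g) = ret (S :&: T) g.
Proof.
apply: (@pres_morph_ext _ _ _ (ret S \o ret T) (ret (S :&: T))) => v /=.
rewrite !ret_gen /ret_vertex inE andbC.
by case: ifP => _ /=; rewrite ?gmulf1 // ret_gen.
Qed.

(** The subgroup generated by [S], encoded as the fixed points of the retraction: closure follows
    from the morphism laws, and [sub_ind] recovers generation. *)
Definition sub S : {pred raag G} := fun g => ret S g == g.

Lemma subE S g : (g \in sub S) = (ret S g == g).
Proof. by []. Qed.

Lemma sub_mul S : mulg_closed (sub S).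
Proof. by move=> g h /eqP Sg /eqP Sh; rewrite subE gmulfM Sg Sh. Qed.
Lemma sub_one S : 1 \in sub S.
Proof. by rewrite subE gmulf1. Qed.
Lemma sub_inv S : invg_closed (sub S).
Proof. by move=> g /eqP Sg; rewrite subE gmulfV Sg. Qed.
HB.instance Definition _ S := isMulClosed.Build (raag G) (sub S) (@sub_mul S).
HB.instance Definition _ S := isMul1Closed.Build (raag G) (sub S) (sub_one S).
HB.instance Definition _ S := isInvClosed.Build (raag G) (sub S) (@sub_inv S).

Lemma sub_ret S g : ret S g \in sub S.
Proof. by rewrite subE ret_comp setIid. Qed.

Lemma sub_letter S a : a.1 \in S -> letter vgen a \in sub S.
Proof. by move=> aS; rewrite subE ret_letter aS. Qed.

(** A fixed point is its own image, and the retraction deletes the letters outside [S] from any word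
    for it. *)
Lemma sub_ind S (Q : raag G -> Prop) : Q 1 ->
  (forall a g, a.1 \in S -> g \in sub S -> Q g -> Q (letter vgen a * g)) ->
  {in sub S, forall g, Q g}.
Proof.
move=> Q1 QM g /eqP <-; elim/presented_ind: g => [|a g IHg].
  by rewrite gmulf1.
rewrite gmulfM ret_letter; case: ifP => aS; last by rewrite mul1g.
by apply: QM => //; apply: sub_ret.
Qed.

Lemma letter_commute v w b c : commute (vgen v) (vgen w) ->
  commute (letter vgen (v, b)) (letter vgen (w, c)).
Proof.
move=> vw; have cV (x y : raag G) : commute x y -> commute x^-1 y.
  by move=> xy; apply/commute_sym/commuteV/commute_sym.
by case: b c => [] []; rewrite /letter /=; do ?[apply: commuteV | apply: cV].
Qed.

Lemma sub_commute S T :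
  (forall v w, v \in S -> w \in T -> commute (vgen v) (vgen w)) ->
  {in sub S & sub T, forall g h, commute g h}.
Proof.
move=> cST g h Sg Th; move: g Sg; apply: sub_ind => [|[v b] g vS _ IHg].
  exact/commute_sym/commute1.
apply/commute_sym/commuteM; last exact/commute_sym.
move: h Th {g IHg}; apply: sub_ind => [|[w c] h wT _ IHh].
  exact/commute_sym/commute1.
apply/commute_sym/commuteM; last exact/commute_sym.
by apply: letter_commute; apply: cST.
Qed.

(** A single generator commutes with itself, so [sub S] is abelian. *)
Lemma P4_law_small S : #|S| <= 1 -> P4_law (fun g => g \in sub S).
Proof.
move=> /card_le1_eqP S1 a b c d Sa _ Sc _ _ _ _.
suff /commgP/eqP-> : commute a c by rewrite comm1g.
apply: (sub_commute (S := S) (T := S)) => // v w vS wS.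
by rewrite (S1 v w).
Qed.

(** * Joins and disjoint unions of vertex sets *)

Section Split.
Variables S T : {set G}.
Hypothesis dis_ST : [disjoint S & T].

(** Letters of [S] and [T] commute, so each element is the product of its two retractions; these are
    morphisms, and the law is checked in each. *)
Lemma P4_law_join : (forall v w, v \in S -> w \in T -> adj v w) ->
  P4_law (fun g => g \in sub S) -> P4_law (fun g => g \in sub T) ->
  P4_law (fun g => g \in sub (S :|: T)).
Proof.
move=> adjST lawS lawT a b c d Ua Ub Uc Ud ab bc cd.
have dec : {in sub (S :|: T), forall g, g = ret S g * ret T g}.
  apply: sub_ind => [|x g xU _ IHg]; first by rewrite !gmulf1 mulg1.
  rewrite !gmulfM !ret_letter; move: xU; rewrite inE => /orP[xS|xT].
    by rewrite xS (disjointFr dis_ST xS) mul1g -mulgA -IHg.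
  rewrite xT (disjointFl dis_ST xT) mul1g {1}IHg !mulgA; congr (_ * _).
  apply/commute_sym; apply: (sub_commute (S := S) (T := T)).
  - by move=> v w vS wT; apply/vgen_commute/adjST.
  - exact: sub_ret.
  - exact: sub_letter.
have Uw : [~ [~ a, c], [~ b, d]] \in sub (S :|: T) by rewrite !gpredR.
rewrite (dec _ Uw) !gmulfR.
rewrite lawS ?lawT ?mulg1 ?[_ \in _]sub_ret //; exact: gmulf_commute.
Qed.

Hypothesis nadjST : forall v w, v \in S -> w \in T -> ~~ adj v w.

(** [true] stands for [S], so that for a vertex [v] of [S :|: T] the boolean [v \in S] is the index
    of its factor. *)
Definition factor (i : bool) : groupClosed (raag G) :=
  sub (if i then S else T).

Local Notation reduced := (reduced factor).

(** Letters outside [S :|: T] are first retracted to 1, so that all of [raag G] acts on the reduced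
    words. *)
Let act_letter (a : G * bool) :=
  syl_mul (a.1 \in S) (ret (S :|: T) (letter vgen a)).
Let act_word (u : seq (G * bool)) s := foldr act_letter s u.

Let act_letter_reduced a s : reduced s -> reduced (act_letter a s).
Proof.
move=> red_s; apply: reduced_mul => //; rewrite ret_letter inE.
case: ifP => [|_]; last exact: gpred1.
by case: (boolP (a.1 \in S)) => /= aS aT; apply: sub_letter.
Qed.

Let act_word_reduced u s : reduced s -> reduced (act_word u s).
Proof. by move=> red_s; elim: u => //= a u; apply: act_letter_reduced. Qed.

Let act_cancel x b s : reduced s ->
  act_letter (x, b) (act_letter (x, ~~ b) s) = s.
Proof.
move=> red_s; rewrite /act_letter /= -(syl_mulM _ _ _ red_s) -gmulfM.
have -> : letter vgen (x, b) * letter vgen (x, ~~ b) = 1.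
  by case: b; rewrite /letter /= ?mulgV ?mulVg.
by rewrite gmulf1 syl_mul1.
Qed.

Let act_outside a s : a.1 \notin S :|: T -> act_letter a s = s.
Proof. by move=> aU; rewrite /act_letter ret_letter (negPf aU) syl_mul1. Qed.

(** If one vertex lies outside [S :|: T], the letters of the other cancel. Otherwise [nadjST] puts
    both in one factor, and the four letters combine into a single [syl_mul] by a trivial
    commutator. *)
Let act_relator v w s : adj v w -> reduced s ->
  act_word (commutator_word v w) s = s.
Proof.
move=> vw red_s; rewrite /act_word /=.
have [vU|vU] := boolP (v \in S :|: T); last first.
  by rewrite !(@act_outside (v, _)) // (act_cancel w false).
have [wU|wU] := boolP (w \in S :|: T); last first.
  by rewrite !(@act_outside (w, _)) // (act_cancel v false).
have svw : (v \in S) = (w \in S).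
  move: vU wU; rewrite !inE.
  case: (boolP (v \in S)); case: (boolP (w \in S)) => //=.
    by move=> _ vS _ wT; case/negP: (nadjST vS wT).
  by move=> wS _ vT _; case/negP: (nadjST wS vT); rewrite adj_sym.
rewrite /act_letter /= -svw -!(syl_mulM _ _ _ red_s) -!gmulfM.
have /commgP/eqP vw1 := vgen_commute vw.
by rewrite [X in ret _ X]vw1 gmulf1 syl_mul1.
Qed.

Let act_word_eq u u' s : pres_eq (@raag_relator G) u u' -> reduced s ->
  act_word u s = act_word u' s.
Proof.
move=> eq_u; elim: eq_u s => {u u'} //.
- by move=> u u' _ IH s /IH.
- by move=> u v w _ IHu _ IHv s red_s; rewrite IHu ?IHv.
- move=> u u' v v' _ IHu _ IHv s red_s.
  by rewrite /act_word !foldr_cat -!/(act_word _ _) IHv // IHu // act_word_reduced.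
- by move=> _ [v [w [vw ->]]] s; apply: act_relator.
Qed.

Let act (g : raag G) := act_word (repr g).

Let act_class u s : reduced s -> act (pres_class _ u) s = act_word u s.
Proof. by apply: act_word_eq; apply: repr_pres_class. Qed.

Let actM g h s : reduced s -> act (g * h) s = act g (act h s).
Proof.
move=> red_s; rewrite -{1}(pres_class_repr g) -{1}(pres_class_repr h).
by rewrite -pres_class_cat act_class // /act_word foldr_cat.
Qed.

Let act_letterE a s : reduced s -> act (letter vgen a) s = act_letter a s.
Proof. by move=> red_s; case: a => v b; rewrite letter_gen act_class. Qed.

Let act1 s : reduced s -> act 1 s = s.
Proof. exact: (@act_class [::]). Qed.

(** All letters of [x] act with the same index [i], so [syl_mulM] merges them. *)
Let act_factor i x s : x \in factor i -> reduced s -> act x s = syl_mul i x s.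
Proof.
move: x s; suff: {in sub (if i then S else T),
    forall x s, reduced s -> act x s = syl_mul i x s} by move=> H x s /H; apply.
apply: sub_ind => [s red_s|a g aU Ug IHg s red_s].
  by rewrite act1 ?syl_mul1.
have red_gs : reduced (syl_mul i g s) by apply: reduced_mul.
rewrite actM // IHg // act_letterE // /act_letter (syl_mulM _ _ _ red_s).
have [aS -> //] : a.1 \in S :|: T /\ (a.1 \in S) = i.
  rewrite inE; case: i aU {Ug IHg red_gs} => aU; first by rewrite aU.
  by rewrite (disjointFl dis_ST aU) aU.
by rewrite ret_letter aS.
Qed.

(** Van der Waerden's argument: a reduced word is recovered by letting its product act on the empty
    word. *)
Lemma factor_prod_inj : {in reduced &, injective (@syl_prod (raag G))}.
Proof.
suff actK s : reduced s -> act (syl_prod s) [::] = s.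
  by move=> s t /actK es /actK et e; rewrite -es e et.
elim: s => [|p s IHs] red_s; first by rewrite syl_prod_nil act1.
move: (red_s); rewrite reduced_cons => /and3P[/andP[Ap _] red_s' _].
by rewrite syl_prod_cons actM // IHs // (act_factor Ap) // (syl_mul_cons red_s).
Qed.

Lemma P4_law_disjoint_union :
  P4_law (fun g => g \in sub S) -> P4_law (fun g => g \in sub T) ->
  P4_law (fun g => g \in sub (S :|: T)).
Proof.
move=> lawS lawT.
have UD : {in sub (S :|: T), forall g, in_free_product factor g}.
  apply: sub_ind => [|x g xU _ Dg].
    by apply: (@in_free_product_factor _ factor true); apply: gpred1.
  apply: in_free_productM => //.
  apply: (@in_free_product_factor _ factor (x.1 \in S)).
  by case: (boolP (x.1 \in S)) xU => xS; rewrite inE ?(negPf xS) => xT;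
    apply: sub_letter.
have law : P4_law (in_free_product factor).
  by apply: (free_product_P4_law factor_prod_inj) => -[].
by move=> a b c d /UD Da /UD Db /UD Dc /UD Dd; apply: law.
Qed.

End Split.
End Raag.

(** * Splitting P4-free graphs into joins and disjoint unions *)

Section CographSplit.
Variable V : finType.
Implicit Types (e : rel V) (U S T : {set V}).

(** For symmetric [e] the six conditions force the four vertices to be distinct. A plain relation is
    allowed so that the complement, which may have loops, is covered. *)
Definition P4_free e := forall x y z t,
  ~~ [&& e x y, e y z, e z t, ~~ e x z, ~~ e x t & ~~ e y t].

(** The value [b = true] means a join, [b = false] a disjoint union. *)
Definition splits e U := exists (S T : {set V}) (b : bool),
  [/\ S :|: T = U, [disjoint S & T], S != set0, T != set0
    & {in S & T, forall x y, e x y = b}].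

(** P4 is self-complementary: an induced path [x y z t] of the complement is the induced path
    [z x t y] of [e]. *)
Lemma P4_free_compl e : symmetric e -> P4_free e -> P4_free (fun x y => ~~ e x y).
Proof.
move=> sym_e noP4 x y z t; apply: contra (noP4 z x t y).
rewrite !negbK (sym_e z x) (sym_e t y) (sym_e z y).
by case/and5P=> -> -> -> -> /andP[-> ->].
Qed.

Lemma splits_compl e U : splits (fun x y => ~~ e x y) U -> splits e U.
Proof.
case=> S [T [b [eU dST S0 T0 eST]]]; exists S, T, (~~ b); split=> // x y xS yT.
by rewrite -(eST x y) ?negbK.
Qed.

(** If [v] has no neighbour in [T], then [T] splits off. *)
Lemma splits_add_nonneighbour e S T u v : symmetric e -> P4_free e ->
  [disjoint S & T] -> T != set0 -> v \notin S :|: T ->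
  {in S & T, forall x y, e x y = false} -> u \in S -> ~~ e v u ->
  splits e (v |: (S :|: T)).
Proof.
move=> sym_e noP4 dST T0; rewrite inE negb_or => /andP[vS vT] eST uS vu.
have [/exists_inP[z zT vz]|noz] := boolP [exists z in T, e v z]; last first.
  exists T, (v |: S), false; split=> //.
  - by rewrite setUCA [T :|: S]setUC.
  - rewrite -setI_eq0 setIUr setU_eq0 !setI_eq0 disjoint_sym disjoints1 vT.
    by rewrite disjoint_sym.
  - by apply/set0Pn; exists v; rewrite setU11.
  move=> x y xT /setU1P[->|yS]; last by rewrite sym_e eST.
  by apply: contraNF noz => xv; apply/exists_inP; exists x; rewrite // sym_e.
(* Now [v] has a neighbour [z] in [T], and the set [M] of its non-neighbours in [S] splits off; it
   contains [u]. *)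
pose M := [set x in S | ~~ e v x].
have sMU : M \subset v |: (S :|: T).
  by apply/subsetP=> x; rewrite !inE => /andP[-> _]; rewrite orbT.
exists M, ((v |: (S :|: T)) :\: M), false; split.
- by rewrite -[RHS](setID _ M) (setIidPr sMU).
- by rewrite -setI_eq0 setIDA setDIl setDv set0I.
- by apply/set0Pn; exists u; rewrite inE uS vu.
- by apply/set0Pn; exists v; rewrite !inE eqxx (negPf vS).
move=> x y; rewrite !inE => /andP[xS vx] /andP[yM] /or3P[/eqP->|yS|yT].
- by rewrite sym_e (negPf vx).
- rewrite yS /= negbK in yM.
  (* An edge from [x] in [M] to a neighbour [y] of [v] in [S] would make [x y v z] an induced
     path. *)
  apply/negP=> xy; case/negP: (noP4 x y v z).
  by rewrite xy sym_e yM vz sym_e vx !eST.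
- exact: eST.
Qed.

(** A vertex adjacent to everything splits off as a join; otherwise it has a non-neighbour in [S]
    or, symmetrically, in [T]. *)
Lemma splits_add e S T v : symmetric e -> P4_free e ->
  [disjoint S & T] -> S != set0 -> T != set0 -> v \notin S :|: T ->
  {in S & T, forall x y, e x y = false} -> splits e (v |: (S :|: T)).
Proof.
move=> sym_e noP4 dST S0 T0 vU eST.
have [/exists_inP[u]|complete] := boolP [exists u in S :|: T, ~~ e v u].
  rewrite inE => /orP[uS|uT] vu; first exact: splits_add_nonneighbour uS vu.
  rewrite [S :|: T]setUC; apply: splits_add_nonneighbour uT vu => //.
  - by rewrite disjoint_sym.
  - by rewrite setUC.
  - by move=> x y xT yS; rewrite sym_e eST.
exists [set v], (S :|: T), true; split=> //.
- by rewrite disjoints1.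
- by apply/set0Pn; exists v; rewrite set11.
- by case/set0Pn: S0 => x xS; apply/set0Pn; exists x; rewrite inE xS.
move=> _ y /set1P-> yU; apply: contraNT complete => vy.
by apply/exists_inP; exists y.
Qed.

(** A vertex is removed, the rest is split by induction, and the vertex is put back. If the rest is
    a join, this is done in the complement, where it is a disjoint union. *)
Lemma P4_free_splits e U : symmetric e -> P4_free e -> 2 <= #|U| -> splits e U.
Proof.
move=> sym_e noP4; have [n] := ubnP #|U|; elim: n => // n IHn in U * => Un U2.
have /set0Pn[v vU] : U != set0 by rewrite -card_gt0 ltnW.
have cardU : #|U| = #|U :\ v|.+1 by rewrite (cardsD1 v U) vU.
rewrite cardU ltnS in Un U2; rewrite -(setD1K vU).
have [U1|U1] := leqP #|U :\ v| 1.
  have /cards1P[w Uw] : #|U :\ v| == 1%N by rewrite eqn_leq U1.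
  exists [set v], [set w], (e v w); rewrite Uw; split=> //.
  - by rewrite disjoints1 -Uw setD11.
  - by apply/set0Pn; exists v; rewrite set11.
  - by apply/set0Pn; exists w; rewrite set11.
  by move=> _ _ /set1P-> /set1P->.
have vU' : v \notin U :\ v by rewrite setD11.
have [S [T [b [eU dST S0 T0 eST]]]] := IHn _ Un U1.
rewrite -eU in vU' *; case: b eST => eST; last exact: splits_add.
apply: splits_compl; apply: splits_add => //.
- by move=> x y; rewrite sym_e.
- exact: P4_free_compl.
- by move=> x y xS yT; rewrite eST.
Qed.

End CographSplit.

Lemma P4_law_P4_free (G : sgraph) :
  P4_free (@adj G) -> forall S : {set G}, P4_law (fun g => g \in sub S).
Proof.
move=> noP4 S; have [n] := ubnP #|S|; elim: n => // n IHn in S * => /ltnSE sz.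
have [S1|S1] := leqP #|S| 1; first exact: P4_law_small.
have [A [B [b [eS dAB A0 B0 eAB]]]] := P4_free_splits (@adj_sym G) noP4 S1.
have szS : #|S| = #|A| + #|B|.
  by move: dAB; rewrite -eS cardsU -setI_eq0 => /eqP->; rewrite cards0 subn0.
have lawA : P4_law (fun g => g \in sub A).
  by apply: IHn; apply: leq_trans sz; rewrite szS -addn1 leq_add2l card_gt0.
have lawB : P4_law (fun g => g \in sub B).
  by apply: IHn; apply: leq_trans sz; rewrite szS -add1n leq_add2r card_gt0.
rewrite -eS; case: b eAB => eAB.
  by apply: P4_law_join.
by apply: P4_law_disjoint_union => // v w vA wB; rewrite eAB.
Qed.

(** * Embeddings of A(P4) *)

Lemma sub_setT (G : sgraph) (g : raag G) : g \in sub [set: G].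
Proof.
elim/presented_ind: g => [|a g IHg]; first exact: gpred1.
by rewrite gpredM // sub_letter // inE.
Qed.

Lemma P4_law_raag (G : sgraph) : P4_free (@adj G) -> @P4_law (raag G) (fun=> True).
Proof.
move=> noP4 a b c d _ _ _ _.
by apply: (P4_law_P4_free noP4 (S := [set: G])); apply: sub_setT.
Qed.

Definition P4_vertex k (lt_k4 : k < 4) : P4 := Ordinal lt_k4.

Local Notation "''p_' k" := (@P4_vertex k isT) (at level 8, k at level 2).
Local Notation "''o_' k" := (@Ordinal 5 k isT) (at level 8, k at level 2).

(* Transpositions of S_5 whose commutation graph is the path a, b, c, d; the  *)
(* commutators [a, c] and [b, d] are 3-cycles sharing a single point. *)
Definition P4_perm (i : P4) : {perm 'I_5} :=
  nth 1 [:: tperm 'o_2 'o_3; tperm 'o_0 'o_1; tperm 'o_3 'o_4; tperm 'o_1 'o_2] i.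

Lemma P4_perm_commute i j : adj i j -> commute (P4_perm i) (P4_perm j).
Proof.
have disj (x y z t : 'I_5) : uniq [:: x; y; z; t] ->
    commute (tperm x y) (tperm z t).
  rewrite /= !inE !negb_or => /and4P[/and3P[_ xz xt] /andP[yz yt] _ _].
  by apply/commgP/conjg_fixP; rewrite tpermJ !tpermD // eq_sym.
case: i j => [[|[|[|[|//]]]] ?] [[|[|[|[|//]]]] ?] //= _; exact: disj.
Qed.

Lemma P4_perm_law_fails :
  [~ [~ P4_perm 'p_0, P4_perm 'p_2], [~ P4_perm 'p_1, P4_perm 'p_3]] != 1.
Proof.
(* The point 2 is the one shared by the two 3-cycles; their products in the two orders differ
   there. *)
apply/negP=> /commgP/permP/(_ 'o_2).
by rewrite /commg /conjg !tpermV !permM /= !permE.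
Qed.

Lemma embeds_P4_not_P4_free (G : sgraph) :
  embeds (raag P4) (raag G) -> ~ P4_free (@adj G).
Proof.
case=> f inj_f noP4.
(* [embeds] supplies only multiplicativity; preservation of 1 follows by cancellation in the group
   and is packed into [F], so that commutators are preserved. *)
have f1 : f 1 = 1 by apply: (mulgI (f 1)); rewrite -gmulfM !mulg1.
pose M := Multiplicative_isUMagmaMorphism.Build _ _ f f1.
pose F : UMagmaMorphism.type (raag P4) (raag G) :=
  HB.pack (Multiplicative.sort f) M.
have comm k l (k4 : k < 4) (l4 : l < 4) : l = k.+1 ->
    commute (f (vgen (P4_vertex k4))) (f (vgen (P4_vertex l4))).
  by move=> e; apply/gmulf_commute/vgen_commute; rewrite /= /P4_adj /= e eqxx.
have := P4_law_raag noP4 I I I I (comm 0%N 1%N isT isT erefl)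
  (comm 1%N 2%N isT isT erefl) (comm 2%N 3%N isT isT erefl).
rewrite -!(gmulfR F) -{1}f1 => /inj_f.
(* Injectivity has pulled the law back to the generators of A(P4); the homomorphism to S_5 now
   contradicts it. *)
move/(congr1 (pres_lift (raag_relator_value P4_perm_commute))).
rewrite gmulf1 !gmulfR /= /vgen !pres_lift_gen => e.
by case/eqP: P4_perm_law_fails.
Qed.

(** A left inverse [g] sends [vgen (h x)] to [vgen x] and kills the vertices outside the image of
    [h]. It respects the relators because [h] reflects adjacency. *)
Lemma embeds_induced (H G : sgraph) (h : H -> G) : injective h ->
  (forall x y, adj (h x) (h y) = adj x y) -> embeds (raag H) (raag G).
Proof.
move=> inj_h adj_h.
have hC x y : adj x y -> commute (vgen (h x)) (vgen (h y)).
  by move=> xy; apply: vgen_commute; rewrite adj_h.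
pose k (v : G) : raag H := if [pick x | h x == v] is Some x then vgen x else 1.
have kC v w : adj v w -> commute (k v) (k w).
  rewrite /k; case: pickP => [x /eqP <-|_ _]; last exact/commute_sym/commute1.
  case: pickP => [y /eqP <-|_ _]; last exact: commute1.
  by rewrite adj_h; apply: vgen_commute.
pose f : UMagmaMorphism.type (raag H) (raag G) := pres_lift (raag_relator_value hC).
pose g : UMagmaMorphism.type (raag G) (raag H) := pres_lift (raag_relator_value kC).
exists f; apply: (can_inj (g := g)) => x.
apply: (@pres_morph_ext _ _ _ (g \o f) idfun) => {}x /=.
rewrite /vgen !pres_lift_gen /k; case: pickP => [y /eqP/inj_h-> //|/(_ x)].
by rewrite eqxx.
Qed.

Lemma induced_P4 (G : sgraph) (x y z t : G) :
  [&& adj x y, adj y z, adj z t, ~~ adj x z, ~~ adj x t & ~~ adj y t] ->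
  exists S : {set G}, graph_iso P4 (induced S).
Proof.
case/and5P=> xy yz zt /negPf xz /andP[/negPf xt /negPf yt].
pose h (i : P4) := nth x [:: x; y; z; t] i.
have adj_h i j : adj (h i) (h j) = adj i j.
  by case: i j => [[|[|[|[|//]]]] ?] [[|[|[|[|//]]]] ?];
    rewrite /h /= ?adj_irrefl // 1?adj_sym ?xy ?yz ?zt ?xz ?xt ?yt //
      1?adj_sym ?xy ?yz ?zt ?xz ?xt ?yt.
(* Distinct vertices of P4 have distinct neighbourhoods, and [h] preserves and reflects
   adjacency. *)
have inj_h : injective h.
  move=> i j eq_h.
  have row k : adj i k = adj j k by rewrite -!adj_h eq_h.
  apply: val_inj; move: (row 'p_0) (row 'p_1) (row 'p_2) (row 'p_3).
  by case: i j {eq_h row} => [[|[|[|[|//]]]] ?] [[|[|[|[|//]]]] ?].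
have hS i : h i \in [set h j | j : P4] by apply: imset_f.
exists [set h j | j : P4], (fun i => exist _ (h i) (hS i)); split=> //.
apply: inj_card_bij => [i j [/inj_h] //|].
by rewrite card_sig card_imset.
Qed.

Theorem theorem6 (G : sgraph) :
  embeds (raag P4) (raag G) <-> exists S : {set G}, graph_iso P4 (induced S).
Proof.
split=> [emb|[S [f [bij_f adj_f]]]].
  apply: boolp.contrapT => noS; apply: (embeds_P4_not_P4_free emb) => x y z t.
  by apply/negP=> /induced_P4.
apply: (@embeds_induced _ _ (val \o f)) => //.
exact: inj_comp val_inj (bij_inj bij_f).
Qed.
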